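(* Let $W:\mathbb{R}_+\times\mathbb{R}\times\mathcal{I}\to\mathbb{R}$ be a separable weighting of the form $W(E,x_1,x_2)=W_1(E)W_2(x_1,x_2)$, where $W_1\in C^1(\mathbb{R}_+)$ and $W_2\in C^1(\mathbb{R}\times\mathcal{I})$ are non-vanishing, $W_2$ is symmetric about $x_1=0$ (i.e. $W_2(-x_1,x_2)=W_2(x_1,x_2)$), and, for any $x_2\in\mathcal{I}$, $W_2(\cdot,x_2)\in C^1(\mathbb{R})$ is bounded and has bounded first order derivative (in $x_1$) on $[-w(x_2),w(x_2)]$. Further let $c_\epsilon E_M<c_2E_m$ be satisfied for all pairs $(x_2,\epsilon)=(x_2,\Phi(x_2))$ with $x_2\in\mathcal{I}$, where $c_2=q_1(w(x_2))$ and $c_\epsilon=q_1(0)$. Then the offset Bragg transform $\mathfrak{B}_\epsilon$ is injective on $L^2_0(\mathfrak{E}\times\mathbb{R}\times\mathcal{I})$.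
   Context: Notation: $\mathbb{R}_+=(0,\infty)$, $\mathcal{I}=(-1,1)$, and $\mathfrak{E}=[E_m,E_M]$ with $0<E_m<E_M$ fixed. $L^2_0(\Omega)$ is the set of (real-valued) $L^2$ functions with compact support on $\Omega$; $f\in L^2_0(\mathfrak{E}\times\mathbb{R}\times\mathcal{I})$ is extended by zero to values of its first variable $q$ outside $\mathfrak{E}$. $\chi_S$ is the characteristic function of a set $S$. ''Non-vanishing'' means nowhere zero. Fix $\beta\in(0,\pi)$ and set $w(x_2)=(1+x_2)\tan\frac{\beta}{2}$ for $x_2\in\mathcal{I}$. Fix a diffeomorphism $\Phi:\mathcal{I}\to\Phi(\mathcal{I})\subset\mathbb{R}$ with $0\le\Phi(x_2)\le M$ for all $x_2\in\mathcal{I}$, for some $M>0$. For $x_2\in\mathcal{I}$ and $\epsilon=\Phi(x_2)$ define $$q_1(x_1)=\frac{1}{\sqrt2}\sqrt{1+\frac{x_1^2-(1-x_2^2)}{\sqrt{x_1^2+(x_2+1)^2}\,\sqrt{x_1^2+(1-x_2)^2+\epsilon^2}}},\qquad x_1\in\mathbb{R}$$ (so $q_1$ depends on $x_2$). The offset Bragg transform (with weighting $W$), regarded as a linear map $\mathfrak{B}_\epsilon:L^2_0(\mathfrak{E}\times\mathbb{R}\times\mathcal{I})\to L^2(\mathbb{R}_+\times\mathbb{R}\times\Phi(\mathcal{I}))$, is $$\mathfrak{B}_\epsilon f(E,s_1,\epsilon)=\int_{\mathbb{R}}\chi_{[-w(x_2),w(x_2)]}(x_1-s_1)\,W\left(E,x_1-s_1,\Phi^{-1}(\epsilon)\right)f\left(Eq_1(x_1-s_1),x_1,\Phi^{-1}(\epsilon)\right)\mathrm{d}x_1,$$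 for $E\in\mathbb{R}_+$, $s_1\in\mathbb{R}$, $\epsilon\in\Phi(\mathcal{I})$, with $x_2=\Phi^{-1}(\epsilon)$. Injectivity means: if $\mathfrak{B}_\epsilon f=0$ almost everywhere then $f=0$ almost everywhere. *)

(* Defs.v *)
From mathcomp Require Import all_boot all_order all_algebra.
From mathcomp Require Import all_classical all_reals all_analysis.

Set Implicit Arguments.
Unset Strict Implicit.
Unset Printing Implicit Defensive.

Import Order.TTheory GRing.Theory Num.Theory.
Import numFieldNormedType.Exports.

Local Open Scope classical_set_scope.
Local Open Scope ring_scope.

(* For finite-dimensional V, continuity of p |-> 'd f p v for every v is
   continuity of p |-> 'd f p. Meant for open sets U: differentiability and
   continuity at p refer to full neighbourhoods of p. *)
Definition C1_on (R : realType) (V : normedModType R) (U : set V)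
    (f : V -> R) : Prop :=
  forall p, U p ->
    differentiable f p /\
    forall v : V, {for p, continuous (fun p' => ('d f p' v : R))}.

(* If A is open in R, then so is f @` A (f is continuous and injective on the
   intervals composing A), so C1_on is used on an open set both times. *)
Definition diffeomorphism_on (R : realType) (A : set R) (f : R -> R) : Prop :=
  [/\ {in A &, injective f}, C1_on A f & C1_on (f @` A) (pinv A f)].

(* Functions of (q, x1, x2), or of (E, s1, epsilon), are functions on
   (R * R) * R; box A B C is A x B x C. *)
Definition box (R : realType) (A B C : set R) : set (R * R * R) :=
  (A `*` B) `*` C.

Definition lebesgue3 (R : realType) :=
  ((@lebesgue_measure R) \x (@lebesgue_measure R)
    \x (@lebesgue_measure R))%E.

(* The compact support of an element of L^2(Omega) is the support of an
   almost-everywhere class. *)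
Definition L20 (R : realType) (Omega : set (R * R * R)) (f : R * R * R -> R)
    : Prop :=
  (f \_ Omega : _ -> R) \in Lfun (@lebesgue3 R) 2%:E /\
  exists K : set (R * R * R),
    [/\ compact K, K `<=` Omega &
        {ae @lebesgue3 R, forall p, (Omega `\` K) p -> f p = 0}].

Section bragg.
Variable R : realType.
Implicit Types (beta eps Em EM : R) (Phi : R -> R) (W : R -> R -> R -> R).

Definition Rpos : set R := [set E | 0 < E].
Definition Ical : set R := `]-1, 1[.
Definition Efrak Em EM : set R := `[Em, EM].

Definition width beta (x2 : R) : R := (1 + x2) * tan (beta / 2).

Definition q1 eps (x2 x1 : R) : R :=
  (Num.sqrt 2)^-1 *
  Num.sqrt (1 + (x1 ^+ 2 - (1 - x2 ^+ 2)) /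
    (Num.sqrt (x1 ^+ 2 + (x2 + 1) ^+ 2) *
     Num.sqrt (x1 ^+ 2 + (1 - x2) ^+ 2 + eps ^+ 2))).

Definition offset_bragg beta Em EM Phi W (f : R * R * R -> R)
    (p : R * R * R) : R :=
  let E := p.1.1 in let s1 := p.1.2 in let eps := p.2 in
  let x2 := pinv Ical Phi eps in
  \int[@lebesgue_measure R]_x1
    (\1_(`[- width beta x2, width beta x2]%classic) (x1 - s1) *
     W E (x1 - s1) x2 *
     (f \_ (box (Efrak Em EM) setT Ical))
       (E * q1 eps x2 (x1 - s1), x1, x2)).

End bragg.

(* Main.v *)
(* For fixed x2 the transform is a multiplicative convolution in q and an
   additive one in x1.  Write h(q, x) = f(q, x, x2), a = q1 and let k be W2 cut
   off to [-w, w].  Integrating E^m s^n (Bf)(E, s) / W1(E) and substituting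
   q = E a(u), x = s + u gives
     0 = \int k(u) a(u)^(-m-1) (\int\int q^m (x - u)^n h(q, x) dq dx) du.
   By induction on n the inner integral is the (m, n) moment of h, independent
   of u, and the factor \int k a^(-m-1) is nonzero since W2 has constant sign.
   So all moments of the compactly supported h vanish, hence h = 0.  In one
   variable this follows by testing against (1 - Y^n)^(2^n), Y affine, which
   converge boundedly to the indicator of a half-line.
   Here a > 0 as soon as Phi(x2) <> 0, which fails for at most one x2.  Null
   sets of eps pull back under Phi to null sets of x2 because Phi^-1 is locally
   Lipschitz. *)
Require Import Defs.
From HB Require Import structures.
From mathcomp Require Import all_boot all_order all_algebra.
From mathcomp Require Import all_classical all_reals all_analysis.
From mathcomp Require Import measurable_realfun.
From mathcomp Require Import ring lra.

Set Implicit Arguments.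
Unset Strict Implicit.
Unset Printing Implicit Defensive.

Import Order.TTheory GRing.Theory Num.Theory.
Import numFieldNormedType.Exports.

Local Open Scope classical_set_scope.
Local Open Scope ring_scope.

(** * Almost-everywhere statements on products *)

Lemma ae_mono d (T : measurableType d) (R : realType)
    (mu : {measure set T -> \bar R}) (P Q : T -> Prop) :
  (forall x, P x -> Q x) ->
  {ae mu, forall x, P x} -> {ae mu, forall x, Q x}.
Proof.
by move=> PQ; apply: filterS; exact: PQ.
Qed.

Lemma ae_mono2 d (T : measurableType d) (R : realType)
    (mu : {measure set T -> \bar R}) (P Q S : T -> Prop) :
  (forall x, P x -> Q x -> S x) ->
  {ae mu, forall x, P x} -> {ae mu, forall x, Q x} -> {ae mu, forall x, S x}.
Proof.
by move=> PQS; apply: filterS2; exact: PQS.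
Qed.

Lemma sigma_finite_product d1 d2 (T1 : measurableType d1)
    (T2 : measurableType d2) (R : realType)
    (m1 : {sigma_finite_measure set T1 -> \bar R})
    (m2 : {sigma_finite_measure set T2 -> \bar R}) :
  sigma_finite setT (m1 \x m2)%E.
Proof.
by case: (lebesgue_integral_fubini.measure_function_Measure_isSigmaFinite__to__measure_function_isSigmaFinite m1 m2).
Qed.

(* Canonical inference finds the sigma-finite structure of a product only for
   subprobabilities, hence this explicit one. *)
Definition lebesgue2 (R : realType) :
    {sigma_finite_measure set (measurableTypeR R * measurableTypeR R)%type -> \bar R} :=
  HB.pack ((@lebesgue_measure R) \x (@lebesgue_measure R))%E
    (Measure_isSigmaFinite.Build _ _ _ _
      (sigma_finite_product (@lebesgue_measure R) (@lebesgue_measure R))).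

(** Tonelli for [|g|]: almost every inner integral is 0, hence so is the double integral. *)
Lemma ae_eq0_of_slices d1 d2 (T1 : measurableType d1) (T2 : measurableType d2)
    (R : realType) (m1 : {sigma_finite_measure set T1 -> \bar R})
    (m2 : {sigma_finite_measure set T2 -> \bar R}) (g : T1 * T2 -> R) :
  measurable_fun setT g ->
  {ae m2, forall y, {ae m1, forall x, g (x, y) = 0}} ->
  {ae (m1 \x m2)%E, forall z, g z = 0}.
Proof.
move=> mg gs; have mEg : measurable_fun setT (EFin \o g).
  exact/measurable_EFinP.
have mag : measurable_fun setT (abse \o (EFin \o g)).
  exact: measurableT_comp.
have int0 : (\int[m1 \x m2]_z `|(EFin \o g) z| = 0)%E.
  rewrite (@fubini_tonelli2 _ _ _ _ _ m1 m2 _ mag); last first.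
    by move=> z; exact: abse_ge0.
  rewrite (ae_eq_integral (cst 0%E))//; first by rewrite integral0.
    by apply: (measurable_fun_fubini_tonelli_G (abse \o (EFin \o g))) => //=.
  apply: ae_mono gs => y gy _; rewrite /fubini_G (ae_eq_integral (cst 0%E))//.
  - by rewrite integral0.
  - exact: measurable_fun_pair1 mag.
  - by apply: ae_mono gy => x /= -> _; rewrite normr0.
have := (ae_eq_integral_abs (m1 \x m2)%E measurableT mEg).1 int0.
by apply: ae_mono => z /(_ I) [].
Qed.

(** By Tonelli the measures of the sections of a measurable null set [N] covering the exceptional
    points integrate to 0, so almost all of them vanish. *)
Lemma ae_ysection d1 d2 (T1 : measurableType d1) (T2 : measurableType d2)
    (R : realType) (m1 : {sigma_finite_measure set T1 -> \bar R})
    (m2 : {sigma_finite_measure set T2 -> \bar R}) (P : T1 * T2 -> Prop) :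
  {ae (m1 \x m2)%E, forall z, P z} ->
  {ae m2, forall y, {ae m1, forall x, P (x, y)}}.
Proof.
move=> [N [mN N0 PN]].
have : (\int[m2]_y `|m1 (ysection N y)| = 0)%E.
  under eq_integral do rewrite gee0_abs//.
  rewrite -[RHS]N0 -[in RHS](setIT N) -integral_indic//.
  rewrite (@fubini_tonelli2 _ _ _ _ _ m1 m2 (fun z => (\1_N z)%:E))//.
    apply: eq_integral => y _.
    by have /(congr1 (@^~ y)) /= <- := indic_fubini_tonelli_GE m1 mN.
  exact/measurable_EFinP.
move=> /(ae_eq_integral_abs m2 measurableT (measurable_fun_ysection m1 mN)).
apply: ae_mono => y /(_ I) /= Ny0.
exists (ysection N y); split => //; first exact: measurable_ysection.
by move=> x /= nP; rewrite /ysection/= inE; exact: PN.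
Qed.

(** * Affine changes of variables *)

(** Uniqueness of Lebesgue measure: [a] times the pushforward agrees with it on half-open
    intervals. *)
Lemma lebesgue_measure_affine (R : realType) (a b : R) (A : set R) :
  0 < a -> measurable A ->
  lebesgue_measure ((fun x => a * x + b) @^-1` A) =
  ((a^-1)%:E * lebesgue_measure A)%E.
Proof.
move=> a0 mA.
have mf : measurable_fun setT (fun x : R => a * x + b).
  by apply: measurable_funD => //; exact: measurable_funM.
pose f (x : R) : measurableTypeR R := a * x + b.
pose nu := mscale (NngNum (ltW a0)) (pushforward (@lebesgue_measure R) f).
have : lebesgue_measure A = nu mf A.
  apply: lebesgue_measure_unique => //= _ [[c d]] _ <-.
  have pre : f @^-1` `]c, d] = `](c - b) / a, (d - b) / a]%classic.
    apply/seteqP; split => x /=; rewrite !in_itv/= /f.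
      by rewrite ltr_pdivrMr// ler_pdivlMr// ltrBlDr lerBrDr mulrC.
    by rewrite ltr_pdivrMr// ler_pdivlMr// ltrBlDr lerBrDr mulrC.
  transitivity (a%:E * lebesgue_measure (f @^-1` `]c, d]))%E; last by [].
  rewrite pre.
  rewrite !lebesgue_measure_itv/= !lte_fin ltr_pM2r ?invr_gt0// ltrD2r.
  case: ifPn => _; last by rewrite mule0.
  by rewrite -!EFinD -EFinM; congr EFin; field; rewrite gt_eqF.
move=> ->; rewrite /nu/= /mscale/= /pushforward muleA -EFinM.
by rewrite mulVf ?gt_eqF// mul1e.
Qed.

(* [lebesgue_measure] lives on [measurableTypeR R], whose display does not unify
   with that of the default measurable structure of [R]. *)
Section affine2.
Context {R : realType}.
Local Notation RT := (measurableTypeR R).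
Local Notation mu := (@lebesgue_measure R).
Local Notation mu2 := (lebesgue2 R).
Variables a b : R.
Hypothesis a0 : 0 < a.
Let phi (z : RT * RT) : RT * RT := (a * z.1, z.2 + b).

Let mphi : measurable_fun setT phi.
Proof.
apply: measurable_fun_pair => /=.
  by apply: measurable_funM => //; exact: measurable_fst.
by apply: measurable_funD => //; exact: measurable_snd.
Qed.

Lemma lebesgue2_affine (A : set (RT * RT)) : measurable A ->
  mu2 (phi @^-1` A) = ((a^-1)%:E * mu2 A)%E.
Proof.
move=> mA.
(* The existential hides the construction of [nu], the pushforward scaled by [a]; only its values
   matter for the comparison with [mu2] on rectangles. *)
have [nu nuE] : exists nu : {measure set (RT * RT) -> \bar R},
    forall B, nu B = (a%:E * mu2 (phi @^-1` B))%E.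
  unshelve eexists (mscale (NngNum (ltW a0)) (pushforward mu2 phi)) => //.
have : mu2 A = nu A.
  apply: (@product_measure_unique _ _ _ _ _ mu mu nu) => // B C mB mC.
  rewrite nuE.
  have -> : phi @^-1` (B `*` C) = ((fun x => a * x + 0) @^-1` B) `*`
      ((fun x => 1 * x + b) @^-1` C).
    by apply/seteqP; split => -[x y] /=; rewrite addr0 mul1r.
  have pre (c d : R) D : measurable D ->
      measurable ((fun x : R => c * x + d) @^-1` D).
    move=> mD; rewrite -[X in measurable X]setTI.
    have : measurable_fun setT (fun x : R => c * x + d).
      by apply: measurable_funD => //; exact: measurable_funM.
    exact.
  have EP := @product_measure1E _ _ _ _ _ mu mu _ _ (pre a 0 B mB) (pre 1 b C mC).
  rewrite [X in (_ * X)%E]EP.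
  have EB := lebesgue_measure_affine 0 a0 mB.
  have EC := lebesgue_measure_affine b ltr01 mC.
  rewrite [X in (_ * (X * _))%E]EB [X in (_ * (_ * X))%E]EC.
  by rewrite invr1 mul1e !muleA -EFinM mulfV ?gt_eqF// mul1e.
by move=> ->; rewrite nuE muleA -EFinM mulVf ?gt_eqF// mul1e.
Qed.

Let ia0 : 0 <= a^-1. Proof. by rewrite invr_ge0 ltW. Qed.

Lemma ge0_integral_affine2 (f : RT * RT -> \bar R) : measurable_fun setT f ->
  (forall z, 0 <= f z)%E ->
  (\int[mu2]_z f (phi z) = (a^-1)%:E * \int[mu2]_z f z)%E.
Proof.
move=> mf f0.
have := ge0_integral_pushforward mphi mu2 measurableT mf (fun z _ => f0 z).
rewrite preimage_setT => <-.
have := ge0_integral_mscale mu2 measurableT (NngNum ia0) mf (fun z _ => f0 z).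
move=> /= <-; apply: eq_measure_integral => A mA _ /=.
exact: lebesgue2_affine.
Qed.

Lemma integrable_affine2 (f : RT * RT -> \bar R) :
  mu2.-integrable setT f -> mu2.-integrable setT (f \o phi).
Proof.
move=> /integrableP[mf foo]; apply/integrableP; split.
  exact: measurableT_comp.
have mf' : measurable_fun setT (fun z => `|f z|%E) by exact: measurableT_comp.
rewrite [ltLHS](ge0_integral_affine2 mf')//.
by rewrite lte_mul_pinfty// lee_fin invr_ge0 ltW.
Qed.

Lemma integral_affine2 (f : RT * RT -> \bar R) : mu2.-integrable setT f ->
  (\int[mu2]_z f (phi z) = (a^-1)%:E * \int[mu2]_z f z)%E.
Proof.
move=> fi; have mf := measurable_int _ fi.
rewrite integralE [in RHS]integralE.
under eq_integral do rewrite (funepos_comp f phi)/=.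
under [X in (_ - X)%E = _]eq_integral do rewrite (funeneg_comp f phi)/=.
have mp := measurable_funepos mf; have mn := measurable_funeneg mf.
rewrite (ge0_integral_affine2 mp)//.
rewrite (ge0_integral_affine2 mn)//.
rewrite [RHS]muleBr//; apply: fin_num_adde_defr.
exact: integrable_pos_fin_num.
Qed.

End affine2.

(** * Vanishing moments *)

Lemma integrable_horner d (T : measurableType d) (R : realType)
    (mu : {measure set T -> \bar R}) (X g : T -> R) (p : {poly R}) :
  (forall i, mu.-integrable setT (fun z => (X z ^+ i * g z)%:E)) ->
  mu.-integrable setT (fun z => (p.[X z] * g z)%:E).
Proof.
move=> Xg.
have -> : (fun z => (p.[X z] * g z)%:E) =
    (fun z => (\sum_(i < size p) (p`_i)%:E * (X z ^+ i * g z)%:E)%E).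
  apply/funext => z; rewrite horner_coef big_distrl/= sumEFin.
  by congr EFin; apply: eq_bigr => i _; rewrite mulrA.
by apply: integrable_sum => // i _; exact: integrableZl.
Qed.

(** Used with [X] the identity in the one-variable moment problem, and with [X] the second
    coordinate when [(x - u)^n] is expanded. *)
Lemma Rintegral_horner d (T : measurableType d) (R : realType)
    (mu : {measure set T -> \bar R}) (X g : T -> R) (p : {poly R}) :
  (forall i, mu.-integrable setT (fun z => (X z ^+ i * g z)%:E)) ->
  \int[mu]_z (p.[X z] * g z) =
  \sum_(i < size p) p`_i * \int[mu]_z (X z ^+ i * g z).
Proof.
move=> Xg; rewrite {1}/Rintegral.
have -> : (\int[mu]_z (p.[X z] * g z)%:E =
    \int[mu]_z (\sum_(i < size p) (p`_i)%:E * (X z ^+ i * g z)%:E))%E.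
  apply: eq_integral => z _; rewrite horner_coef big_distrl/= sumEFin.
  by congr EFin; apply: eq_bigr => i _; rewrite mulrA.
rewrite integral_sum//; last by move=> i; exact: integrableZl.
rewrite -sum_fine; last first.
  by move=> i _; apply: integrable_fin_num => //; exact: integrableZl.
by apply: eq_bigr => i _; rewrite -(RintegralZl _ measurableT (Xg i)).
Qed.

Section step_polynomials.
Context {R : realType}.
Implicit Types (t y : R) (N n : nat).

Lemma bernoulli_inequality t N : -1 <= t -> 1 + N%:R * t <= (1 + t) ^+ N.
Proof.
move=> t1; elim: N => [|N ih]; first by rewrite mul0r addr0 expr0.
rewrite exprS.
have h : 0 <= 1 + t by rewrite -lerBlDl sub0r.
apply: le_trans (ler_wpM2l h ih).
(* [N t^2] is the surplus of [(1 + t) (1 + N t)] over [1 + (N + 1) t]. *)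
have : 0 <= N%:R * t ^+ 2 by rewrite mulr_ge0// sqr_ge0.
by rewrite -natr1; nra.
Qed.

(* The polynomials [(1 - X^n)^(2^n)] converge to the indicator of [X < 1/2]
   on the unit interval (Brosowski-Deutsch). *)
Lemma cvg_step_lt y : 0 <= y < 2^-1 ->
  (1 - y ^+ n) ^+ (2 ^ n) @[n --> \oo] --> (1 : R).
Proof.
move=> /andP[y0 y2].
(* Bernoulli with [t = - y^n] and exponent [2^n]; the lower bound tends to 1 because [2 y < 1]. *)
have h n : 1 - (2 * y) ^+ n <= (1 - y ^+ n) ^+ (2 ^ n) <= 1.
  have yn1 : y ^+ n <= 1 by apply: exprn_ile1 => //; lra.
  have yn0 : 0 <= y ^+ n by exact: exprn_ge0.
  apply/andP; split; last by apply: exprn_ile1; lra.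
  have := @bernoulli_inequality (- y ^+ n) (2 ^ n).
  by rewrite exprMn natrX mulrN lerN2; apply.
apply: (@squeeze_cvgr _ _ _ _ (fun n => 1 - (2 * y) ^+ n) (cst 1)).
- by near=> n.
- rewrite -[X in _ --> X]subr0; apply: cvgB; first exact: cvg_cst.
  by apply: cvg_expr; rewrite ger0_norm; lra.
- exact: cvg_cst.
Unshelve. all: by end_near. Qed.

(** Since [(1 - y^n) (1 + y^n) <= 1] and, by Bernoulli, [(1 + y^n)^(2^n) >= (2 y)^n], the sequence
    is at most [(2 y)^(-n)], where [2 y > 1]. *)
Lemma cvg_step_gt y : 2^-1 < y <= 1 ->
  (1 - y ^+ n) ^+ (2 ^ n) @[n --> \oo] --> (0 : R).
Proof.
move=> /andP[y2 y1].
have y0 : 0 < 2 * y by lra.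
have h n : 0 <= (1 - y ^+ n) ^+ (2 ^ n) <= ((2 * y)^-1) ^+ n.
  have yn1 : y ^+ n <= 1 by apply: exprn_ile1 => //; lra.
  have yn0 : 0 <= y ^+ n by apply: exprn_ge0; lra.
  apply/andP; split; first by apply: exprn_ge0; lra.
  rewrite exprVn -[leRHS]mul1r ler_pdivlMr ?exprn_gt0//.
  have le1 : (1 - y ^+ n) ^+ (2 ^ n) * (1 + y ^+ n) ^+ (2 ^ n) <= 1.
    by rewrite -exprMn; apply: exprn_ile1; nra.
  apply: le_trans le1; apply: ler_wpM2l; first by apply: exprn_ge0; lra.
  have := @bernoulli_inequality (y ^+ n) (2 ^ n).
  by rewrite exprMn natrX => H; have := H ltac:(lra); lra.
apply: (@squeeze_cvgr _ _ _ _ (cst 0) (fun n => ((2 * y)^-1) ^+ n)).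
- by near=> n.
- exact: cvg_cst.
- apply: cvg_expr; rewrite ger0_norm ?invr_ge0; last lra.
  by rewrite invf_lt1; lra.
Unshelve. all: by end_near. Qed.

End step_polynomials.

Section moments1.
Context {R : realType}.
Local Notation RT := (measurableTypeR R).
Local Notation mu := (@lebesgue_measure R).
Variables (g : RT -> R) (r : R).
Hypothesis intg : mu.-integrable setT (EFin \o g).
Hypothesis suppg : forall x, r < `|x| -> g x = 0.
Hypothesis momg : forall n, \int[mu]_x (x ^+ n * g x) = 0.

Let mg : measurable_fun setT g.
Proof. by have /measurable_EFinP := measurable_int _ intg. Qed.

Lemma integrable_moment n : mu.-integrable setT (fun x : RT => (x ^+ n * g x)%:E).
Proof.
(* The sign of [r] is free, hence [|r|] in the dominating function. *)
apply: (@le_integrable _ _ _ _ _ _ _ (fun x => (`|r| ^+ n)%:E * (g x)%:E)%E) => //.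
- by apply/measurable_EFinP; apply: measurable_funM.
- move=> x _; rewrite -EFinM lee_fin !normrM !normrX normr_id.
  have [rx|xr] := ltP r `|x|; first by rewrite suppg// normr0 !mulr0.
  apply: ler_wpM2r => //; apply: lerXn2r; rewrite ?nnegrE//.
  by apply: (le_trans xr); rewrite ler_norm.
- exact: integrableZl.
Qed.

(** Dominated convergence: on the support the polynomials [p n] stay in [[0, 1]] and tend to the
    indicator of []-oo, c]] except at [c]; by linearity each integrates to 0 against [g]. *)
Let int_le c : \int[mu]_(x in `]-oo, c]) g x = 0.
Proof.
(* For [|x| <= rho] one has [|x - c| < 2 rho], so the slope [1 / (4 rho)] keeps [Y] in [[0, 1]],
   with [Y = 1/2] exactly at [c]. *)
pose rho := Num.max r `|c| + 1.
have rrho : r < rho by rewrite (@le_lt_trans _ _ (Num.max r `|c|)) ?le_max ?lexx// ltrDl.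
have crho : `|c| < rho.
  by rewrite (@le_lt_trans _ _ (Num.max r `|c|)) ?le_max ?lexx ?orbT// ltrDl.
have rho0 : 0 < rho by exact: le_lt_trans crho.
pose Y : {poly R} := (4 * rho)^-1 *: ('X - c%:P) + (2^-1)%:P.
have YE x : Y.[x] = (x - c) / (4 * rho) + 2^-1.
  by rewrite /Y !hornerE mulrC.
have Y01 x : `|x| <= rho -> 0 <= Y.[x] <= 1.
  have d0 : 0 < 4 * rho by lra.
  move=> xrho; rewrite YE -lerBlDr sub0r -lerBrDr.
  apply/andP; rewrite (ler_pdivlMr _ _ d0) (ler_pdivrMr _ _ d0); split;
  move: xrho crho; rewrite ler_norml ltr_norml => /andP[? ?] /andP[? ?]; lra.
pose p n : {poly R} := (1 - Y ^+ n) ^+ (2 ^ n).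
have pE n x : (p n).[x] = (1 - Y.[x] ^+ n) ^+ (2 ^ n).
  by rewrite /p horner_exp !hornerE.
have int0 n : \int[mu]_x ((p n).[x] * g x) = 0.
  rewrite (Rintegral_horner (X := fun x : RT => x : R) _ integrable_moment).
  by rewrite big1// => i _; rewrite momg mulr0.
have intp n := integrable_horner (X := fun x : RT => x : R) (p n) integrable_moment.
rewrite Rintegral_mkcond.
have [] := @dominated_convergence _ _ _ mu setT measurableT
   (fun n x => ((p n).[x] * g x)%:E) (EFin \o (g \_ `]-oo, c]))
   (fun x => `|(g x)%:E|%E).
- by move=> n; exact: (measurable_int _ (intp n)).
- apply/measurable_EFinP; apply/(measurable_restrictT _ _).1 => //.
  exact: measurable_funTS.
(* At [c] neither step limit applies, but a point is null. *)
- exists [set c]; split => //=; first by rewrite lebesgue_measure_set1.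
  move=> x /= H; apply: contrapT => /eqP xc; apply: H => _.
  apply: cvg_EFin; first by near=> n.
  rewrite [X in X @ _ --> _](_ : _ =
      (fun n => (1 - Y.[x] ^+ n) ^+ (2 ^ n) * g x)); last first.
    by apply/funext => n /=; rewrite pE.
  have [rx|xr] := ltP rho `|x|.
    rewrite patchE suppg ?(lt_trans rrho)//.
    rewrite (_ : (fun n => _) = cst 0); last by apply/funext => n; rewrite mulr0.
    by case: ifPn => _; exact: cvg_cst.
  have := Y01 _ xr => /andP[Y0 Y1].
  move: xc; rewrite neq_lt => /orP[xc|cx].
    rewrite patchE mem_set/= ?in_itv/= ?ltW// -[X in _ --> X]mul1r.
    apply: cvgM; last exact: cvg_cst.
    apply: cvg_step_lt; rewrite Y0 YE.
    have : (x - c) / (4 * rho) < 0 by rewrite pmulr_llt0 ?invr_gt0; lra.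
    lra.
  rewrite patchE memNset/= ?in_itv/=; last by apply/negP; rewrite -ltNge.
  rewrite -[X in _ --> X](mul0r (g x)).
  apply: cvgM; last exact: cvg_cst.
  apply: cvg_step_gt; rewrite Y1 YE andbT.
  have : 0 < (x - c) / (4 * rho) by rewrite divr_gt0; lra.
  lra.
- exact: integrable_abse.
- apply: aeW => x n _; rewrite lee_fin normrM.
  have [rx|xr] := ltP rho `|x|.
    by rewrite suppg ?(lt_trans rrho)// normr0 mulr0.
  rewrite ler_piMl// pE normrX; have /andP[Y0 Y1] := Y01 _ xr.
  have y1 : Y.[x] ^+ n <= 1 by exact: exprn_ile1.
  have y0 : 0 <= Y.[x] ^+ n by exact: exprn_ge0.
  by apply: exprn_ile1; rewrite ger0_norm; lra.
rewrite (_ : [sequence \int[mu]_x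
    (fun n x => ((p n).[x] * g x)%:E) n x]_n%E = cst 0%E); last first.
  apply/funext => n /=; rewrite -[LHS]fineK; last exact: integrable_fin_num.
  by congr EFin; exact: int0.
move=> _ _ h; rewrite /Rintegral.
by have := cvg_unique _ h (cvg_cst _); move=> /(_ (@ereal_hausdorff R)) ->.
Unshelve. all: by end_near. Qed.

(** Lebesgue differentiation: the primitive over []-oo, x]] has derivative [g x] almost everywhere,
    and it is identically 0 by [int_le]. *)
Lemma moments_eq0_ae : {ae mu, forall x, g x = 0}.
Proof.
have FE : (fun x : R => \int[mu]_(t in `]-oo, x]) g t) = cst 0.
  by apply/funext => x; rewrite int_le.
have locg : locally_integrable [set: R] g.
  by have := integrable_locally measurableT intg; rewrite patch_setT.
have inty y : mu.-integrable `]-oo, y] (EFin \o g).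
  exact: integrableS intg.
have := FTC1Ny inty locg.
apply: filterS; first exact: (ae_filter_ringOfSetsType mu).
by move=> x /=; rewrite FE derive1_cst => -[_ <-].
Qed.

End moments1.

Lemma integrable_fubini_G d1 d2 (T1 : measurableType d1)
    (T2 : measurableType d2) (R : realType)
    (m1 : {sigma_finite_measure set T1 -> \bar R})
    (m2 : {sigma_finite_measure set T2 -> \bar R}) (f : T1 * T2 -> \bar R) :
  (m1 \x m2)%E.-integrable setT f -> m2.-integrable setT (fubini_G m1 f).
Proof.
move=> intf; have mf := measurable_int _ intf.
have mG := measurable_fubini_G intf.
apply/integrableP; split => //.
apply: le_lt_trans ((integrable21ltyP _ _ mf).1 intf).
have maf : measurable_fun setT (abse \o f) by exact: measurableT_comp.
apply: ge0_le_integral => //.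
- exact: measurableT_comp.
- by apply: (measurable_fun_fubini_tonelli_G (abse \o f)) => //=.
- move=> y _; apply: le_abse_integral => //.
  exact: measurable_fun_pair1 mf.
Qed.

Section moments2.
Context {R : realType}.
Local Notation RT := (measurableTypeR R).
Local Notation mu := (@lebesgue_measure R).
Local Notation mu2 := (lebesgue2 R).
Variables (h : RT * RT -> R) (r : R).
Hypothesis inth : mu2.-integrable setT (EFin \o h).
Hypothesis supph : forall z, r < `|z.1| \/ r < `|z.2| -> h z = 0.

Let mh : measurable_fun setT h.
Proof. by have /measurable_EFinP := measurable_int _ inth. Qed.

Lemma measurable_monomial2 m n :
  measurable_fun setT (fun z : RT * RT => z.1 ^+ m * z.2 ^+ n : R).
Proof.
apply: measurable_funM; apply: measurable_funX.
  exact: measurable_fst.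
exact: measurable_snd.
Qed.

Lemma integrable_moment2 m n :
  mu2.-integrable setT (fun z => (z.1 ^+ m * z.2 ^+ n * h z)%:E).
Proof.
apply: (@le_integrable _ _ _ _ _ _ _
  (fun z => (`|r| ^+ m * `|r| ^+ n)%:E * (h z)%:E)%E) => //.
- by apply/measurable_EFinP; apply: measurable_funM => //; exact: measurable_monomial2.
- move=> z _; rewrite -EFinM lee_fin !normrM !normrX !normr_id.
  have [rz|zr] := ltP r `|z.1|.
    by rewrite supph; [rewrite normr0 !mulr0|left].
  have [rz|zr2] := ltP r `|z.2|.
    by rewrite supph; [rewrite normr0 !mulr0|right].
  have rr := ler_norm r.
  apply: ler_wpM2r => //; apply: ler_pM; rewrite ?exprn_ge0//.
    by apply: lerXn2r; rewrite ?nnegrE// (le_trans zr).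
  by apply: lerXn2r; rewrite ?nnegrE// (le_trans zr2).
- exact: integrableZl.
Qed.

Hypothesis momh : forall m n, \int[mu2]_z (z.1 ^+ m * z.2 ^+ n * h z) = 0.

(** Only almost every slice is known to be integrable, so identities for this partial moment are
    stated almost everywhere. *)
Let hm m (x : RT) : R := \int[mu]_q (q ^+ m * h (q, x)).

Let int_slice m :
  {ae mu, forall x, mu.-integrable setT (fun q : RT => (q ^+ m * h (q, x))%:E)}.
Proof.
have := ae_integrable2 (integrable_moment2 m 0).
apply: ae_mono.
by move=> x /=; under eq_fun do rewrite expr0 mulr1.
Qed.

Let hmE m n : {ae mu, forall x, setT x ->
  (x ^+ n * hm m x)%:E = (\int[mu]_q (q ^+ m * x ^+ n * h (q, x))%:E)%E}.
Proof.
have := int_slice m.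
apply: ae_mono.
move=> x ix _; rewrite /hm -RintegralZl// /Rintegral fineK; last first.
  apply: integrable_fin_num => //.
  exact: (integrableZl measurableT (x ^+ n) ix).
by apply: eq_integral => q _; rewrite mulrA (mulrC (x ^+ n)).
Qed.

(** Inherited from the inner Fubini integral of [q^m x^n h], which agrees almost everywhere. *)
Let int_hm m n : mu.-integrable setT (fun x : RT => (x ^+ n * hm m x)%:E).
Proof.
have iG := integrable_fubini_G (integrable_moment2 m n).
have /integrableP[mG Goo] := iG.
have mhm : measurable_fun setT (hm m).
  have /= := measurable_fubini_G (integrable_moment2 m 0).
  rewrite /fubini_G/=; under eq_fun do under eq_integral do rewrite expr0 mulr1.
  by move=> ?; apply: measurableT_comp => //; exact: measurable_fine.
have mxhm : measurable_fun setT (fun x : RT => (x ^+ n * hm m x)%:E).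
  by apply/measurable_EFinP; apply: measurable_funM.
apply/integrableP; split => //; apply: le_lt_trans Goo.
rewrite le_eqVlt; apply/orP; left; apply/eqP; apply: ae_eq_integral => //.
- exact: measurableT_comp.
- exact: measurableT_comp.
- by apply: (ae_mono _ (hmE m n)) => x /[apply] ->.
Qed.

(** The one-variable result is applied twice: in [x] to [hm m] for each [m], then in [q] to almost
    every slice of [h]. *)
Lemma moments2_eq0_ae : {ae mu2, forall z, h z = 0}.
Proof.
have hm0 m : {ae mu, forall x, hm m x = 0}.
  apply: (@moments_eq0_ae _ _ r).
  - have := int_hm m 0.
    by under eq_fun do rewrite expr0 mul1r.
  - move=> x rx; rewrite /hm /Rintegral integral0_eq// => q _.
    by rewrite supph ?mulr0//; right.
  - move=> n; rewrite /Rintegral.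
    rewrite (ae_eq_integral (fun x : RT =>
      \int[mu]_q (q ^+ m * x ^+ n * h (q, x))%:E)%E)//.
    + rewrite (integral21_prod_meas1 (integrable_moment2 m n)).
      exact: momh.
    + exact: (measurable_int _ (int_hm m n)).
    + exact: (measurable_fubini_G (integrable_moment2 m n)).
    + exact: hmE.
have hs : {ae mu, forall x, {ae mu, forall q, h (q, x) = 0}}.
  (* There are countably many [m], so almost every slice has all its moments zero at once. *)
  have := @ae_foralln _ _ _ mu _ hm0.
  have := int_slice 0.
  apply: ae_mono2.
  move=> x ix hx; apply: (@moments_eq0_ae _ (fun q => h (q, x)) r) => //.
  - by move: ix; under eq_fun do rewrite expr0 mul1r.
  - by move=> q rq; apply: supph; left.
exact: (ae_eq0_of_slices mh hs).
Qed.

End moments2.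

(** * Moments of the transform *)

Section moment_transform.
Context {R : realType}.
Local Notation RT := (measurableTypeR R).
Local Notation mu := (@lebesgue_measure R).
Local Notation mu2 := (lebesgue2 R).
(* [h'] is a version of [h] with exactly bounded support; the transform keeps
   [h], whose values on a null set could matter on individual curves. *)
Variables (h h' : RT * RT -> R) (r : R).
Hypothesis mh : measurable_fun setT h.
Hypothesis inth' : mu2.-integrable setT (EFin \o h').
Hypothesis supph' : forall z, r < `|z.1| \/ r < `|z.2| -> h' z = 0.
Hypothesis hh' : {ae mu2, forall z, h z = h' z}.
Variables (k a : RT -> R) (w : R).
Hypothesis mk : measurable_fun setT k.
Hypothesis ma : measurable_fun setT a.
Hypothesis a_gt0 : forall u, 0 < a u.
Hypothesis suppk : forall u, w < `|u| -> k u = 0.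
(** In the exponent [m + 1], [m] comes from [E^m = q^m a(u)^(-m)] and 1 from the Jacobian of
    [q = E a(u)]. *)
Hypothesis intk : forall m,
  mu.-integrable setT (fun u => (k u * (a u)^-1 ^+ m.+1)%:E).
Hypothesis intk_neq0 : forall m, \int[mu]_u (k u * (a u)^-1 ^+ m.+1) != 0.
(** Integrability along the curve is a premise because shifting the variable and pulling [W1 E] out
    of the integral rely on it; Fubini supplies it for almost every [z]. *)
Hypothesis transform0 :
  {ae mu2, forall z,
    mu.-integrable setT (fun u => (k u * h (z.1 * a u, z.2 + u))%:E) ->
    \int[mu]_u (k u * h (z.1 * a u, z.2 + u)) = 0}.

Let mh' : measurable_fun setT h'.
Proof. by have /measurable_EFinP := measurable_int _ inth'. Qed.

Let H m n (uz : RT * (RT * RT)) : R :=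
  uz.2.1 ^+ m * uz.2.2 ^+ n *
  (k uz.1 * h (uz.2.1 * a uz.1, uz.2.2 + uz.1)).

Let m1 : measurable_fun setT (fun uz : RT * (RT * RT) => uz.1 : R).
Proof. exact: measurable_fst. Qed.

Let m21 : measurable_fun setT (fun uz : RT * (RT * RT) => uz.2.1 : R).
Proof. exact: (measurableT_comp measurable_fst measurable_snd). Qed.

Let m22 : measurable_fun setT (fun uz : RT * (RT * RT) => uz.2.2 : R).
Proof. exact: (measurableT_comp measurable_snd measurable_snd). Qed.

Let mH m n : measurable_fun setT (H m n).
Proof.
apply: measurable_funM.
  by apply: measurable_funM; exact: measurable_funX.
apply: measurable_funM; first exact: (measurableT_comp mk measurable_fst).
apply: (measurableT_comp mh); apply: measurable_fun_pair.
  by apply: measurable_funM => //; exact: (measurableT_comp ma measurable_fst).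
exact: measurable_funD.
Qed.

(** What [E^m s^n] times [f] becomes under [q = E a(u)], [x = s + u], up to the factor [a(u)^(-m)];
    [f] will be [h] or [h']. *)
Let F (f : RT * RT -> R) m n (u : R) (z : RT * RT) : R :=
  z.1 ^+ m * (z.2 - u) ^+ n * f z.

Let mF f m n u : measurable_fun setT f -> measurable_fun setT (F f m n u).
Proof.
move=> mf; apply: measurable_funM => //; apply: measurable_funM.
  by apply: measurable_funX; exact: measurable_fst.
by apply: measurable_funX; apply: measurable_funB.
Qed.

Let HE m n u z : H m n (u, z) =
  k u * (a u)^-1 ^+ m * F h m n u (a u * z.1, z.2 + u).
Proof.
rewrite /H /F/= addrK (mulrC z.1).
have <- : (a u)^-1 ^+ m * (a u * z.1) ^+ m = z.1 ^+ m.
  by rewrite -exprMn mulKf// gt_eqF.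
by ring.
Qed.

Let C m n : R := `|r| ^+ m * (`|r| + `|w|) ^+ n.

Let F'_le m n u z : `|u| <= w -> `|F h' m n u z| <= C m n * `|h' z|.
Proof.
move=> uw; rewrite /F !normrM !normrX.
have [rz|zr1] := ltP r `|z.1|.
  by rewrite supph'; [rewrite normr0 !mulr0|left].
have [rz|zr2] := ltP r `|z.2|.
  by rewrite supph'; [rewrite normr0 !mulr0|right].
have rr := ler_norm r; have ww := ler_norm w.
apply: ler_wpM2r => //; apply: ler_pM; rewrite ?exprn_ge0//.
  by apply: lerXn2r; rewrite ?nnegrE// (le_trans zr1).
apply: lerXn2r; rewrite ?nnegrE ?addr_ge0//.
apply: (le_trans (ler_normB _ _)); apply: lerD.
  exact: (le_trans zr2).
exact: (le_trans uw).
Qed.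

Let intF' m n u : `|u| <= w -> mu2.-integrable setT (EFin \o F h' m n u).
Proof.
move=> uw; apply: (@le_integrable _ _ _ _ _ _ _
  (fun z => (C m n)%:E * (h' z)%:E)%E) => //.
- by apply/measurable_EFinP; exact: mF.
- move=> z _; rewrite -EFinM lee_fin (le_trans (F'_le _ _ _ uw))//.
  by rewrite normrM ler_wpM2r// ler_norm.
- exact: integrableZl.
Qed.

Let aeF m n u : {ae mu2, forall z, setT z -> (F h m n u z)%:E = (F h' m n u z)%:E}.
Proof. by apply: (ae_mono _ hh') => z hz _; rewrite /F hz. Qed.

Let intF m n u : `|u| <= w -> mu2.-integrable setT (EFin \o F h m n u).
Proof.
move=> uw; have /integrableP[_ oo] := intF' m n uw.
have mf : measurable_fun setT (EFin \o F h m n u).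
  by apply/measurable_EFinP; exact: mF.
apply/integrableP; split => //; apply: le_lt_trans oo.
rewrite le_eqVlt; apply/orP; left; apply/eqP; apply: ae_eq_integral => //.
- exact: measurableT_comp.
- by apply: measurableT_comp => //; apply/measurable_EFinP; exact: mF.
- by apply: (ae_mono _ (aeF m n u)) => z e _; rewrite /comp e.
Qed.

(** Tonelli with [z] inside: for [|u| <= w] the affine substitution bounds the inner integral by a
    constant times [|k u| a(u)^(-m-1)]; for [|u| > w] it is 0. *)
Let intH m n : (mu \x mu2)%E.-integrable setT (EFin \o H m n).
Proof.
have mEH : measurable_fun setT (EFin \o H m n) by exact/measurable_EFinP.
apply/(integrable12ltyP mu mu2 mEH).
pose C' := (\int[mu2]_z `|(C m n * h' z)%:E|)%E.
have C'oo : (C' < +oo)%E.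
  by have /integrableP[] := integrableZl measurableT (C m n) inth'.
have C'fin : C' \is a fin_num.
  by rewrite ge0_fin_numE//; apply: integral_ge0.
have /integrableP[mk' koo] := integrableZr measurableT (fine C') (intk m).
apply: le_lt_trans koo; apply: ge0_le_integral => //.
- move=> u _; exact: integral_ge0.
- by apply: (measurable_fun_fubini_tonelli_F (abse \o (EFin \o H m n))) => //=;
    exact: measurableT_comp.
- exact: measurableT_comp.
move=> u _ /=; have [wu|uw] := ltP w `|u|.
  rewrite integral0_eq ?lee_fin// => z _.
  by rewrite /H/= suppk// mul0r mulr0 normr0.
have ia0 : 0 <= (a u)^-1 by rewrite invr_ge0 ltW.
pose G z := `|(F h m n u z)%:E|%E.
have mG : measurable_fun setT G.
  by apply: measurableT_comp => //; apply/measurable_EFinP; exact: mF.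
have G0 z : (0 <= G z)%E by exact: abse_ge0.
have -> : (\int[mu2]_z `|(H m n (u, z))%:E| = `|k u * (a u)^-1 ^+ m|%:E *
    \int[mu2]_z G (a u * z.1, z.2 + u)%R)%E.
  rewrite -ge0_integralZl//.
    by apply: eq_integral => z _; rewrite HE /G -abse_EFin -abseM.
  apply: (measurableT_comp mG); apply: measurable_fun_pair.
    by apply: measurable_funM => //; exact: measurable_fst.
  by apply: measurable_funD => //; exact: measurable_snd.
rewrite [X in (_ * X)%E](ge0_integral_affine2 u (a_gt0 u) mG)//.
have C'0 : 0 <= fine C' by rewrite fine_ge0// integral_ge0.
have -> : `|k u * (a u)^-1 ^+ m.+1 * fine C'| =
    `|k u * (a u)^-1 ^+ m| * ((a u)^-1 * fine C').
  by rewrite exprSr !normrM (ger0_norm C'0) (ger0_norm ia0) !mulrA.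
rewrite EFinM; apply: lee_wpmul2l => //.
rewrite EFinM; apply: lee_wpmul2l; rewrite ?lee_fin// fineK//.
(* The pointwise bound [F'_le] concerns [h'], so [h] is exchanged for it under the integral. *)
have -> : (\int[mu2]_z G z = \int[mu2]_z `|(F h' m n u z)%:E|)%E.
  apply: ae_eq_integral => //.
    by apply: measurableT_comp => //; apply/measurable_EFinP; exact: mF.
  by apply: (ae_mono _ (aeF m n u)) => z e _; rewrite /G e.
apply: ge0_le_integral => //.
- by apply: measurableT_comp => //; apply/measurable_EFinP; exact: mF.
- by apply: measurableT_comp => //; apply/measurable_EFinP; exact: measurable_funM.
- move=> z _; rewrite lee_fin (le_trans (F'_le _ _ _ uw))// normrM.
  by rewrite ler_wpM2r// ler_norm.
Qed.

Let M m n : R := \int[mu2]_z (z.1 ^+ m * z.2 ^+ n * h' z).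

(** Expand [(x - u)^n] in powers of [x]: the lower terms carry moments [M m j] with [j < n], which
    are 0, and the leading coefficient is 1. *)
Let intFE m n u : `|u| <= w -> (forall j, (j < n)%N -> M m j = 0) ->
  (\int[mu2]_z (F h m n u z)%:E = (M m n)%:E)%E.
Proof.
move=> uw M0.
rewrite (ae_eq_integral (fun z => (F h' m n u z)%:E) _ measurableT); last first.
- exact: aeF.
- by apply/measurable_EFinP; exact: mF.
- by apply/measurable_EFinP; exact: mF.
rewrite -[LHS]fineK; last by apply: integrable_fin_num => //; exact: intF'.
congr EFin.
have intm j : mu2.-integrable setT
    (fun z => (z.2 ^+ j * (z.1 ^+ m * h' z))%:E).
  have := integrable_moment2 inth' supph' m j.
  by under eq_fun do rewrite mulrAC mulrC.
have -> : fine (\int[mu2]_z (F h' m n u z)%:E) = \int[mu2]_z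
    ((('X - u%:P) ^+ n : {poly R}).[z.2] * (z.1 ^+ m * h' z)).
  congr fine; apply: eq_integral => z _; rewrite /F horner_exp hornerXsubC.
  by congr EFin; ring.
rewrite (Rintegral_horner _ intm) size_exp_XsubC big_ord_recr/=.
have cn : (('X - u%:P) ^+ n : {poly R})`_n = 1.
  have := monic_exp n (monicXsubC u).
  by rewrite monicE lead_coefE size_exp_XsubC => /eqP.
have eqM j : \int[mu2]_z (z.2 ^+ j * (z.1 ^+ m * h' z)) = M m j.
  by congr fine; apply: eq_integral => z _; rewrite mulrCA mulrA.
rewrite big1 ?add0r ?cn ?mul1r// => j _.
by rewrite eqM M0// mulr0.
Qed.

(** Strong induction on [n] with [m] fixed. Fubini for [H]: integrating over [z] first gives [M m n]
    times a nonzero factor, integrating over [u] first gives 0. *)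
Lemma moments_transform_eq0 m n : M m n = 0.
Proof.
elim/ltn_ind: n => n ih.
have := Fubini (intH m n) => /=.
have -> : (\int[mu]_u \int[mu2]_z (H m n (u, z))%:E =
    \int[mu]_u ((M m n)%:E * (k u * (a u)^-1 ^+ m.+1)%:E))%E.
  apply: eq_integral => u _.
  have [wu|uw] := ltP w `|u|.
    rewrite integral0_eq//; first by rewrite suppk// mul0r mule0.
    by move=> z _; rewrite /H/= suppk// mul0r mulr0.
  have -> : (\int[mu2]_z (H m n (u, z))%:E = (k u * (a u)^-1 ^+ m)%:E *
      \int[mu2]_z (F h m n u (a u * z.1, z.2 + u)%R)%:E)%E.
    rewrite -integralZl//.
      by apply: eq_integral => z _; rewrite HE EFinM.
    exact: (integrable_affine2 u (a_gt0 u) (intF m n uw)).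
  have := integral_affine2 u (a_gt0 u) (intF m n uw) => /= ->.
  rewrite intFE// -!EFinM; congr EFin.
  by rewrite exprSr; ring.
rewrite integralZl// => MI.
have MI0 : (\int[mu2]_z \int[mu]_u (H m n (u, z))%:E = 0)%E.
  rewrite (ae_eq_integral (cst 0%E))//; first by rewrite integral0.
    exact: (measurable_fubini_G (intH m n)).
  (* With both exponents 0 the monomial is 1, so this is the premise of [transform0]. *)
  have := ae_integrable2 (intH 0 0); apply: ae_mono2 transform0 => z.
  move=> hz iz _.
  have {}iz : mu.-integrable setT
      (fun u => (k u * h (z.1 * a u, z.2 + u))%:E).
    by move: iz; under eq_fun do rewrite /H/= !expr0 !mul1r.
  have -> : (\int[mu]_u (H m n (u, z))%:E =
      \int[mu]_u ((z.1 ^+ m * z.2 ^+ n)%:E *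
                  (k u * h (z.1 * a u, z.2 + u))%:E))%E by [].
  rewrite integralZl// -[X in (_ * X)%E]fineK; last exact: integrable_fin_num.
  by rewrite [X in (_ * X%:E)%E]hz// mule0.
move: MI; rewrite MI0 -[X in (_ * X)%E]fineK; last exact: integrable_fin_num.
rewrite -EFinM => -[] /eqP.
by rewrite mulf_eq0 (negPf (intk_neq0 m)) orbF => /eqP.
Qed.

Lemma transform_inj : {ae mu2, forall z, h z = 0}.
Proof.
have h'0 := moments2_eq0_ae inth' supph' moments_transform_eq0.
by apply: (ae_mono2 _ hh' h'0) => z ->.
Qed.

End moment_transform.

(** * Null sets and diffeomorphisms *)

Section negligible_preimage.
Context {R : realType}.
Local Notation mu := (@lebesgue_measure R).
Local Notation l := (@wlength R idfun).

(** The part of [S] mapped into an interval of length [d] lies within [L d] of any of its points, so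
    an open cover of [N] pulls back to a cover whose total length grows at most by the factor
    [2 L]. *)
Lemma negligible_preimage_expanding (S N : set R) (f : R -> R) (L : R) :
  (forall x y, S x -> S y -> `|x - y| <= L * `|f x - f y|) ->
  mu.-negligible N -> mu.-negligible (S `&` f @^-1` N).
Proof.
move=> fL N0; pose L' := `|L| + 1.
have L'0 : 0 < L' by rewrite ltr_wpDl.
have {}fL x y : S x -> S y -> `|x - y| <= L' * `|f x - f y|.
  move=> Sx Sy; apply: (le_trans (fL _ _ Sx Sy)); apply: ler_wpM2r => //.
  by rewrite (le_trans (ler_norm L))// lerDl.
apply/negligible_outer_measure/eqP; rewrite eq_le outer_measure_ge0 andbT.
apply/lee_addgt0Pr => e e0; rewrite add0e.
(* The tolerance makes up for the factor [2 L']. *)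
have d0 : 0 < e / (2 * L') by rewrite divr_gt0// mulr_gt0.
move/negligible_outer_measure : N0; rewrite outer_measure_open_itv_cover => N0.
have fN : ereal_inf [set \sum_(k <oo) l (F k) | F in open_itv_cover N]%E
    \is a fin_num by rewrite N0.
have [_ [F [oF NF] <-]] := lb_ereal_inf_adherent d0 fN.
rewrite N0 add0e => sF.
pose G k := S `&` f @^-1` F k.
apply: (@le_trans _ _ (l^* (\bigcup_k G k))%mu).
  apply: le_outer_measure => x [Sx Nx].
  by have [k _ Fk] := NF _ Nx; exists k.
apply: (le_trans (outer_measure_sigma_subadditive l^*%mu G)).
apply: (@le_trans _ _ (\sum_(k <oo) ((2 * L')%:E * l (F k)))%E); last first.
  rewrite nneseriesZl//.
  rewrite -lee_pdivlMl ?mulr_gt0//.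
  by rewrite -EFinM mulrC ltW.
apply: lee_nneseries => [k _ _|k _]; first exact: outer_measure_ge0.
(* A nonempty piece supplies the centre [y] of the covering interval. *)
have [->|/set0P[y [Sy Fy]]] := eqVneq (G k) set0.
  by rewrite outer_measure0 mule_ge0// lee_fin mulr_ge0// ltW.
have [[a b] /= Fab] := oF k.
move: Fy; rewrite /preimage/= Fab /= in_itv/= => /andP[ay yb].
have ab : a < b by exact: lt_trans yb.
apply: (@le_trans _ _ (l^* `[y - L' * (b - a), y + L' * (b - a)]%classic)%mu).
  apply: le_outer_measure => x [Sx]; rewrite /preimage/= Fab /= !in_itv/=.
  move=> /andP[ax xb]; rewrite -ler_distl.
  apply: (le_trans (fL _ _ Sx Sy)); apply: ler_wpM2l; first exact: ltW.
  by rewrite ler_norml; lra.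
have : mu `[y - L' * (b - a), y + L' * (b - a)]%classic = (2 * L' * (b - a))%:E.
  rewrite lebesgue_measure_itv/= lte_fin ifT.
    by rewrite -EFinD; congr EFin; ring.
  by rewrite ltrD2l -subr_gt0 opprK addr_gt0// mulr_gt0// subr_gt0.
move=> E; rewrite [leLHS]E wlength_itv/= lte_fin ab -EFinD -EFinM.
by rewrite lexx.
Qed.

(** Chain rule for [pinv Ical Phi \o Phi], which is the identity near [x]. *)
Lemma diffeomorphism_diff_neq0 (Phi : R -> R) (x : R) :
  diffeomorphism_on (@Ical R) Phi -> Ical x -> 'd Phi x 1 != 0 :> R.
Proof.
move=> [injPhi dPhi dPsi] Ix.
have [dx _] := dPhi x Ix.
have [dy _] := dPsi (Phi x) (ex_intro2 _ _ x Ix erefl).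
have : 'D_1 (pinv (@Ical R) Phi \o Phi) x = 1.
  rewrite (@near_eq_derive _ _ _ _ id)//; first exact: derive_id.
  have := @near_in_itvoo R (-1) 1 x; rewrite inE => /(_ Ix).
  by apply: filterS => y Iy /=; rewrite pinvKV// inE.
have {}dx' := (derivable1_diffP Phi x).2 dx.
have {}dy := (derivable1_diffP (pinv (@Ical R) Phi) (Phi x)).2 dy.
rewrite -derive1E (derive1_comp dx' dy) => DD.
apply/eqP => dPhi0; move: DD.
rewrite [X in _ * X]derive1E deriveE// dPhi0 mulr0.
by move/esym/eqP; rewrite oner_eq0.
Qed.

(** Mean value theorem: by continuity [|Phi'|] stays above half its value at [x] on a small ball,
    and the inverse of that half serves as [L]. *)
Lemma diffeomorphism_expanding_near (Phi : R -> R) (x : R) :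
  diffeomorphism_on (@Ical R) Phi -> Ical x ->
  exists r L : R, 0 < r /\ forall y z, `|x - y| < r -> `|x - z| < r ->
    `|y - z| <= L * `|Phi y - Phi z|.
Proof.
move=> dPhi Ix; have d0 := diffeomorphism_diff_neq0 dPhi Ix.
have [_ CPhi _] := dPhi.
have [_ /(_ 1) cd] := CPhi x Ix.
pose c : R := `|'d Phi x 1| / 2.
have c0 : 0 < c by rewrite divr_gt0// normr_gt0.
have near1 : \forall y \near x, c < `|'d Phi y 1 : R|.
  apply: (cvgr_norm_gt _ cd); rewrite /c ltr_pdivrMr// ltr_pMr ?normr_gt0//.
  by rewrite ltr1n.
have near2 : \forall y \near x, Ical y.
  have := @near_in_itvoo R (-1) 1 x; rewrite inE => /(_ Ix).
  by apply: filterS => y Iy.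
have /nbhs_ballP[r /= r0 xr] : \forall y \near x, Ical y /\ c < `|'d Phi y 1 : R|.
  by near=> y; split; near: y.
exists r, c^-1; split => //.
have key y z : y <= z -> `|x - y| < r -> `|x - z| < r ->
    `|y - z| <= c^-1 * `|Phi y - Phi z|.
  move=> yz xy xz.
  (* The ball is convex, so the mean value point lies in it. *)
  have yzr t : t \in `[y, z] -> Ical t /\ c < `|'d Phi t 1 : R|.
    rewrite in_itv/= => /andP[yt tz]; apply: xr; rewrite /ball/=.
    move: xy xz; rewrite !ltr_norml => /andP[? ?] /andP[? ?].
    by apply/andP; split; lra.
  have diffPhi t : t \in `[y, z] -> derivable Phi t 1.
    by move=> /yzr[It _]; apply/derivable1_diffP; have [] := CPhi t It.
  have [t tyz PhiE] : exists2 t, t \in `[y, z] &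
      Phi z - Phi y = 'd Phi t 1 * (z - y).
    apply: (@MVT_segment _ Phi (fun t => 'd Phi t 1) y z yz) => [t tyz|].
      have {}tyz : t \in `[y, z] by exact: subset_itv_oo_cc tyz.
      apply: DeriveDef; first exact: diffPhi.
      by apply: deriveE; apply/derivable1_diffP; exact: diffPhi.
    exact: derivable_within_continuous.
  rewrite distrC (distrC (Phi y)) PhiE normrM mulrA ler_peMl//.
  have [_ ct] := yzr t tyz.
  by rewrite mulrC ler_pdivlMr// mul1r ltW.
move=> y z xy xz; have [yz|/ltW zy] := leP y z; first exact: key.
by rewrite distrC (distrC (Phi y)); exact: key.
Unshelve. all: by end_near. Qed.

(** The local bounds hold on intervals with rational endpoints and with natural constants, so
    countably many sets [S k] cover [Ical]. *)
Lemma diffeomorphism_negligible_preimage (Phi : R -> R) (N : set R) :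
  diffeomorphism_on (@Ical R) Phi -> mu.-negligible N ->
  mu.-negligible (@Ical R `&` Phi @^-1` N).
Proof.
move=> dPhi N0.
pose expanding (S : set R) (L : R) := forall y z, S y -> S z ->
  `|y - z| <= L * `|Phi y - Phi z|.
pose S (k : rat * rat * nat) : set R := [set x |
  [/\ x \in `]ratr k.1.1, ratr k.1.2[ &
   expanding `]ratr k.1.1, ratr k.1.2[%classic k.2%:R]].
(* Enumeration of the triples by their codes; other numbers give the empty set. *)
pose F k := if unpickle k is Some i then S i `&` Phi @^-1` N else set0.
have F0 k : mu.-negligible (F k).
  rewrite /F; case: unpickle => [i|]; last exact: negligible_set0.
  apply: (@negligible_preimage_expanding _ _ _ i.2%:R) => // y z [yi ex] [zi _].
  exact: ex.
apply: negligibleS (negligible_bigcup F0) => x [Ix Nx].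
have [r [L [r0 rL]]] := diffeomorphism_expanding_near dPhi Ix.
have [p] : exists p : rat, ratr p \in `](x - r), x[ by apply: rat_in_itvoo; lra.
rewrite in_itv/= => /andP[rp px].
have [q] : exists q : rat, ratr q \in `]x, (x + r)[ by apply: rat_in_itvoo; lra.
rewrite in_itv/= => /andP[xq qr].
set n := (Num.truncn `|L|).+1.
exists (pickle (p, q, n)); first exact: I.
rewrite /F pickleK; split; last exact: Nx.
split; first by rewrite in_itv/= px.
move=> y z /=; rewrite !in_itv/= => /andP[py yq] /andP[pz zq].
apply: (le_trans (rL _ _ _ _)); [rewrite ltr_norml; lra..|].
apply: ler_wpM2r => //; apply: (le_trans (ler_norm _)).
exact/ltW/truncnS_gt.
Qed.

End negligible_preimage.

(** * The weight and the curve q1 *)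

Section continuous_weight.
Context {R : realType}.
Local Notation mu := (@lebesgue_measure R).

Lemma continuous_neq0_sign (f : R -> R) : continuous f ->
  (forall x, f x != 0) -> (forall x, 0 < f x) \/ (forall x, f x < 0).
Proof.
move=> cf f0.
have nochange x y : x <= y -> Num.min (f x) (f y) <= 0 <= Num.max (f x) (f y) -> False.
  move=> xy /(IVT xy); case; first exact: continuous_subspaceT.
  by move=> c _ fc; have := f0 c; rewrite fc eqxx.
have same x : (0 < f 0) = (0 < f x).
  apply/idP/idP => [p|p]; rewrite ltNge; apply/negP => n;
    have [x0|/ltW x0] := leP 0 x; apply: (nochange _ _ x0);
    by rewrite ge_min le_max n (ltW p) ?orbT.
have [p|n] := ltP 0 (f 0); [left|right] => x; first by rewrite -same.
by rewrite lt_neqAle f0/= leNgt -same -leNgt.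
Qed.

(** The minimum on the segment is attained, hence positive, and bounds the integral below. *)
Lemma Rintegral_itv_gt0 (f : R -> R) (a b : R) : a < b -> continuous f ->
  (forall x, 0 < f x) -> 0 < \int[mu]_(x in `[a, b]) f x.
Proof.
move=> ab cf f0; have wcf : {within `[a, b], continuous f}.
  exact: continuous_subspaceT.
have [c _ fc] := EVT_min (ltW ab) wcf.
apply: (@lt_le_trans _ _ (\int[mu]_(x in `[a, b]) f c)).
  have E : mu `[a, b]%classic = (b - a)%:E.
    by rewrite lebesgue_measure_itv/= lte_fin ab -EFinD.
  by rewrite Rintegral_cst// [X in fine X]E mulr_gt0// subr_gt0.
apply: le_Rintegral => //.
- apply: continuous_compact_integrable; first exact: segment_compact.
  by apply: continuous_subspaceT => ?; exact: cvg_cst.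
- by apply: continuous_compact_integrable => //; exact: segment_compact.
Qed.

Lemma Rintegral_itv_neq0 (f : R -> R) (a b : R) : a < b -> continuous f ->
  (forall x, f x != 0) -> \int[mu]_(x in `[a, b]) f x != 0.
Proof.
move=> ab cf /(continuous_neq0_sign cf)[f0|f0].
  by rewrite gt_eqF// Rintegral_itv_gt0.
have intf : mu.-integrable `[a, b] (EFin \o f).
  apply: continuous_compact_integrable; first exact: segment_compact.
  exact: continuous_subspaceT.
have : 0 < \int[mu]_(x in `[a, b]) (-1 * f x).
  apply: Rintegral_itv_gt0 => //; last by move=> x; rewrite mulN1r oppr_gt0.
  by move=> x; apply: cvgM; [exact: cvg_cst|exact: cf].
by rewrite RintegralZl// mulN1r oppr_gt0 => /lt_eqF ->.
Qed.

End continuous_weight.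

Section q1_properties.
Context {R : realType}.

Lemma width_gt0 (beta x2 : R) : 0 < beta < pi -> Ical x2 -> 0 < width beta x2.
Proof.
rewrite /Ical/= in_itv/= => /andP[b0 bpi] /andP[x2N1 _].
rewrite /width mulr_gt0//; first lra.
by rewrite /tan divr_gt0 ?sin_gt0_pi ?cos_gt0_pihalf//; apply/andP; split; lra.
Qed.

Variables (eps x2 : R).
Hypotheses (eps0 : 0 < eps) (Ix2 : Ical x2).

Let p0 : 0 < x2 + 1.
Proof. by move: Ix2; rewrite /Ical/= in_itv/= => /andP[? ?]; lra. Qed.

Let A (x1 : R) := x1 ^+ 2 + (x2 + 1) ^+ 2.
Let B (x1 : R) := x1 ^+ 2 + (1 - x2) ^+ 2 + eps ^+ 2.

Let A0 x1 : 0 < A x1.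
Proof. by rewrite ltr_wpDl ?sqr_ge0// exprn_gt0. Qed.

Let B0 x1 : 0 < B x1.
Proof. by rewrite ltr_wpDl ?addr_ge0 ?sqr_ge0// exprn_gt0. Qed.

Let AB0 x1 : 0 < Num.sqrt (A x1) * Num.sqrt (B x1).
Proof. by rewrite mulr_gt0// sqrtr_gt0. Qed.

(* Strict Cauchy-Schwarz: the numerator is the inner product of
   [(x1, x2 + 1, 0)] and [(x1, x2 - 1, eps)], not parallel since [eps != 0]. *)
Let radicand_gt0 (x1 : R) : 0 < 1 + (x1 ^+ 2 - (1 - x2 ^+ 2)) /
  (Num.sqrt (A x1) * Num.sqrt (B x1)).
Proof.
have lt : `|x1 ^+ 2 - (1 - x2 ^+ 2)| < Num.sqrt (A x1) * Num.sqrt (B x1).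
  rewrite -sqrtrM; last exact: ltW.
  rewrite -sqrtr_sqr ltr_sqrt ?mulr_gt0// -subr_gt0.
  (* Lagrange's identity: the right-hand side is the squared length of the cross product. *)
  have -> : A x1 * B x1 - (x1 ^+ 2 - (1 - x2 ^+ 2)) ^+ 2 =
      (2 * x1) ^+ 2 + (x1 * eps) ^+ 2 + ((x2 + 1) * eps) ^+ 2.
    by rewrite /A /B; ring.
  by rewrite ltr_wpDl ?addr_ge0 ?sqr_ge0// exprn_gt0// mulr_gt0.
move: lt; rewrite ltr_norml => /andP[lt _].
by rewrite -ltrBlDl sub0r ltr_pdivlMr// mulN1r.
Qed.

Lemma q1_gt0 x1 : 0 < q1 eps x2 x1.
Proof.
by rewrite /q1 mulr_gt0 ?invr_gt0 ?sqrtr_gt0// radicand_gt0.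
Qed.

Lemma continuous_q1 : continuous (q1 eps x2).
Proof.
have csq : continuous (fun x1 : R => x1 ^+ 2) by move=> x; exact: exprn_continuous.
have cA : continuous A by move=> x; apply: cvgD; [exact: csq|exact: cvg_cst].
have cB : continuous B.
  move=> x; apply: cvgD; last exact: cvg_cst.
  by apply: cvgD; [exact: csq|exact: cvg_cst].
have csqrt (g : R -> R) : continuous g -> continuous (fun x => Num.sqrt (g x)).
  by move=> cg x; apply: continuous_comp; [exact: cg|exact: sqrt_continuous].
have cr : continuous (fun x1 : R => 1 + (x1 ^+ 2 - (1 - x2 ^+ 2)) /
    (Num.sqrt (A x1) * Num.sqrt (B x1))).
  move=> x; apply: cvgD; first exact: cvg_cst.
  apply: cvgM; first by apply: cvgB; [exact: csq|exact: cvg_cst].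
  apply: cvgV; first by rewrite gt_eqF// AB0.
  by apply: cvgM; [exact: csqrt cA x|exact: csqrt cB x].
by move=> x; apply: cvgM; [exact: cvg_cst|exact: csqrt cr x].
Qed.

End q1_properties.

(** * Injectivity *)

Section slice.
Context {R : realType}.
Local Notation RT := (measurableTypeR R).
Local Notation mu := (@lebesgue_measure R).
Local Notation mu2 := (lebesgue2 R).

Lemma Rintegral_shift (G : RT -> R) (s : R) : mu.-integrable setT (EFin \o G) ->
  \int[mu]_x G (x - s) = \int[mu]_x G x.
Proof.
move=> iG; congr fine.
pose f (x : RT) : RT := 1 * x + s.
have mf : measurable_fun setT f.
  by apply: measurable_funD => //; exact: measurable_funM.
pose G' (x : RT) := (G (x - s))%:E.
have G'f : G' \o f = EFin \o G.
  by apply/funext => x; rewrite /G' /f/= mul1r addrK.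
have mG' : measurable_fun setT G'.
  apply/measurable_EFinP; have /measurable_EFinP mG := measurable_int _ iG.
  by apply: (measurableT_comp mG); apply: measurable_funB.
have := integral_pushforward mf mG' (mu := mu) (D := setT).
rewrite preimage_setT G'f => /(_ iG measurableT) => <-.
apply: eq_measure_integral => B mB _ /=; apply/esym.
rewrite /pushforward.
have := lebesgue_measure_affine s ltr01 mB.
by rewrite invr1 mul1e.
Qed.

(** Brings one slice into the form of [transform_inj]: [W2] cut off to [[-w, w]] is the kernel [k],
    and [W1 E] is a nonzero constant on each curve. *)
Lemma bragg_slice_inj (Em w r : R) (V : R -> R -> R) (W1 W2 a : R -> R)
    (h : RT * RT -> R) :
  0 < Em -> 0 < w -> continuous W2 -> (forall u, W2 u != 0) ->
  continuous a -> (forall u, 0 < a u) ->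
  (forall E, 0 < E -> W1 E != 0) ->
  (forall E u, 0 < E -> V E u = W1 E * W2 u) ->
  mu2.-integrable setT (EFin \o h) ->
  (forall z, z.1 < Em -> h z = 0) ->
  {ae mu2, forall z, r < `|z.1| \/ r < `|z.2| -> h z = 0} ->
  {ae mu2, forall z, 0 < z.1 ->
    \int[mu]_x (\1_(`[- w, w]%classic) (x - z.2) * V z.1 (x - z.2) *
      h (z.1 * a (x - z.2), x)) = 0} ->
  {ae mu2, forall z, h z = 0}.
Proof.
move=> Em0 w0 cW2 W20 ca a0 W10 VE ih hEm hr hV.
have mh : measurable_fun setT h.
  by have /measurable_EFinP := measurable_int _ ih.
have mcont (f : R -> R) : continuous f -> measurable_fun setT (f : RT -> R).
  exact: continuous_measurable_fun.
pose k (u : RT) : R := \1_(`[- w, w]%classic) u * W2 u.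
pose B : set (RT * RT) := [set z | `|z.1| <= r /\ `|z.2| <= r].
have mB : measurable B.
  have -> : B = `[- r, r]%classic `*` `[- r, r]%classic.
    by apply/seteqP; split => -[x y]; rewrite /B/= !in_itv/= -!ler_norml.
  exact: measurableX.
pose h' := h \_ B.
have kE m : (fun u : RT => k u * (a u)^-1 ^+ m.+1) =
    (fun u => W2 u * (a u)^-1 ^+ m.+1) \_ `[- w, w].
  by rewrite patch_indic; apply/funext => u; rewrite /k/= -mulrA mulrC.
have cka m : continuous (fun u => W2 u * (a u)^-1 ^+ m.+1).
  move=> u; apply: cvgM; first exact: cW2.
  apply: (@continuous_comp _ _ _ (fun u => (a u)^-1) (fun x => x ^+ m.+1)).
    by apply: cvgV; [rewrite gt_eqF|exact: ca].
  exact: exprn_continuous.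
apply: (@transform_inj _ h h' r _ _ _ _ k a w) => //.
- have : mu2.-integrable setT ((EFin \o h) \_ B).
    by apply/(integrable_mkcond _ mB).1; exact: integrableS ih.
  by rewrite restrict_EFin.
- move=> z rz; rewrite /h' patchE memNset// => -[z1 z2].
  by case: rz; rewrite ltNge ?z1 ?z2.
- apply: ae_mono hr => z hz; rewrite /h' patchE.
  case: ifPn => //; rewrite notin_setE => nBz; apply: hz.
  move/not_andP : nBz => [|] /negP; rewrite -ltNge; [by left|by right].
- by apply: measurable_funM; [exact: measurable_indic|exact: mcont].
- exact: mcont.
- move=> u wu; rewrite /k indicE memNset ?mul0r//= in_itv/= -ler_norml.
  by apply/negP; rewrite -ltNge.
- move=> m; have : mu.-integrable setT
      (EFin \o ((fun u => W2 u * (a u)^-1 ^+ m.+1) \_ `[- w, w])).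
    rewrite -restrict_EFin; apply/(integrable_mkcond _ _).1 => //.
    apply: continuous_compact_integrable; first exact: segment_compact.
    exact: continuous_subspaceT.
  by rewrite -kE.
- move=> m; rewrite kE -Rintegral_mkcond.
  apply: Rintegral_itv_neq0 => //; first by rewrite gtrN.
  by move=> u; rewrite mulf_neq0// expf_neq0// invr_eq0 gt_eqF.
- apply: ae_mono hV => -[E s] /= hz iz.
  (* The equation is given for [E > 0]; for [E <= 0] the whole curve has [q <= 0 < Em], where [h] is
     0. *)
  have [E0|E0] := ltP 0 E; last first.
    rewrite /Rintegral integral0_eq// => u _; rewrite hEm ?mulr0//=.
    by rewrite (le_lt_trans _ Em0)// mulr_le0_ge0// ltW.
  have := hz E0.
  have iG := integrableZl measurableT (W1 E) iz.
  have -> : \int[mu]_x (\1_(`[- w, w]%classic) (x - s) * V E (x - s) *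
        h (E * a (x - s), x)) =
      W1 E * \int[mu]_u (k u * h (E * a u, s + u)).
    rewrite -RintegralZl//.
    rewrite -(@Rintegral_shift (fun u => W1 E * (k u * h (E * a u, s + u))) s iG).
    apply: eq_Rintegral => x _.
    by rewrite VE// /k (addrC s) subrK; ring.
  by move=> /eqP; rewrite mulf_eq0 (negPf (W10 _ E0)) => /eqP.
Qed.

End slice.

(** * Integrability of square-integrable functions with compact support *)

Section cube.
Context {R : realType}.
Local Notation RT := (measurableTypeR R).
Local Notation mu := (@lebesgue_measure R).
Local Notation mu3 := (lebesgue2 R \x mu)%E.

Definition cube (r : R) : set (R * R * R) :=
  box `[- r, r]%classic `[- r, r]%classic `[- r, r]%classic.

Lemma cubeP (r : R) (p : R * R * R) :
  cube r p <-> [/\ `|p.1.1| <= r, `|p.1.2| <= r & `|p.2| <= r].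
Proof.
by rewrite /cube /box/= !in_itv/= -!ler_norml; split=> [[[]]|[]]; split.
Qed.

Lemma measurable_cube (r : R) : measurable (cube r : set (RT * RT * RT)).
Proof. by apply: measurableX => //; exact: measurableX. Qed.

Lemma cube_finite (r : R) : (mu3 (cube r) < +oo)%E.
Proof.
pose I : set R := `[- r, r]%classic.
have fin : (mu I < +oo)%E.
  by rewrite lebesgue_measure_itv/=; case: ifPn => // _; rewrite -EFinD ltry.
have mI : measurable I by exact: measurable_itv.
have E2 : (lebesgue2 R (I `*` I) = mu I * mu I)%E.
  exact: (product_measure1E mu mu mI mI).
have E3 : (mu3 (cube r) = lebesgue2 R (I `*` I) * mu I)%E.
  exact: (product_measure1E (lebesgue2 R) mu (measurableX mI mI) mI).
have fI : mu I \is a fin_num by rewrite ge0_fin_numE.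
by rewrite E3 E2 ltey_eq fin_numM ?fin_numM.
Qed.

Lemma compact_sub_cube (K : set (R * R * R)) : compact K ->
  exists r, K `<=` cube r.
Proof.
move=> /compact_bounded/pinfty_ex_gt0[r r0 Kr]; exists r => p Kp.
have := Kr p Kp; rewrite /= !prod_normE !ge_max => /andP[/andP[p11 p12] p2].
exact/cubeP.
Qed.

(** On the cube, which has finite measure, [|g| <= 1 + g^2]; off it [g] vanishes almost
    everywhere. *)
Lemma square_integrable_integrable (g : RT * RT * RT -> R) (r : R) :
  g \in Lfun mu3 2%:E -> {ae mu3, forall p, ~ cube r p -> g p = 0} ->
  mu3.-integrable setT (EFin \o g).
Proof.
move=> gL2 gr; have isq := Lfun2_integrable_sqr gL2.
have mg : measurable_fun setT g by have := sub_Lfun_mfun gL2; rewrite inE.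
have i1 : mu3.-integrable setT (EFin \o \1_(cube r)).
  apply/integrableP; split.
    by apply/measurable_EFinP; exact: measurable_indic (measurable_cube r).
  under eq_integral do rewrite /= ger0_norm//.
  by rewrite integral_indic ?setIT ?cube_finite//; exact: measurable_cube.
have /integrableP[_ oo] := integrableD measurableT i1 isq.
have mEg : measurable_fun setT (EFin \o g) by exact/measurable_EFinP.
apply/integrableP; split => //; apply: le_lt_trans oo.
pose g1 (p : RT * RT * RT) : \bar R := (\1_(cube r) p * `|g p|)%:E.
have mg1 : measurable_fun setT g1.
  apply/measurable_EFinP; apply: measurable_funM.
    exact: measurable_indic (measurable_cube r).
  exact: measurableT_comp.
rewrite (ae_eq_integral g1)//.
- apply: ge0_le_integral => //.
  + by move=> p _; rewrite lee_fin mulr_ge0.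
  + apply: measurableT_comp => //; apply: emeasurable_funD.
      exact: measurable_int i1.
    exact: measurable_int isq.
  + move=> p _; rewrite /g1/= lee_fin [leRHS]ger0_norm ?addr_ge0 ?sqr_ge0//.
    rewrite indicE; case: (p \in cube r); last by rewrite mul0r add0r sqr_ge0.
    have := sqr_ge0 (`|g p| - 1); rewrite sqrrB mulr1 real_normK ?num_real//.
    by have := normr_ge0 (g p); rewrite /=; lra.
- exact: measurableT_comp.
- apply: ae_mono gr => p gp _; rewrite /g1/= indicE.
  have [pc|npc] := boolP (p \in cube r); first by rewrite mul1r.
  by rewrite mul0r gp ?normr0//; move: npc; rewrite notin_setE.
Qed.

End cube.

Theorem theorem6p1 (R : realType) (Em EM beta M : R) (Phi : R -> R)
  (W : R -> R -> R -> R) (W1 : R -> R) (W2 : R -> R -> R)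
  (hEm : 0 < Em) (hE : Em < EM)
  (hbeta : 0 < beta < pi)
  (hPhi : diffeomorphism_on (@Ical R) Phi)
  (hM : 0 < M)
  (hPhiM : forall x2, Ical x2 -> 0 <= Phi x2 <= M)
  (hW : forall E x1 x2, Rpos E -> Ical x2 -> W E x1 x2 = W1 E * W2 x1 x2)
  (hW1 : C1_on (@Rpos R) W1)
  (hW1nz : forall E, Rpos E -> W1 E != 0)
  (hW2 : C1_on (setT `*` @Ical R) (fun p : R * R => W2 p.1 p.2))
  (hW2nz : forall x1 x2, Ical x2 -> W2 x1 x2 != 0)
  (hW2sym : forall x1 x2, Ical x2 -> W2 (- x1) x2 = W2 x1 x2)
  (hW2C1 : forall x2, Ical x2 -> C1_on [set: R] (fun x1 => W2 x1 x2))
  (hW2bnd : forall x2, Ical x2 ->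
     (exists C : R, forall x1, - width beta x2 <= x1 <= width beta x2 ->
        `|W2 x1 x2| <= C) /\
     (exists C : R, forall x1, - width beta x2 <= x1 <= width beta x2 ->
        `|derive1 (fun y => W2 y x2) x1| <= C))
  (hc : forall x2, Ical x2 ->
     q1 (Phi x2) x2 0 * EM < q1 (Phi x2) x2 (width beta x2) * Em) :
  forall f : R * R * R -> R,
    L20 (box (Efrak Em EM) setT (@Ical R)) f ->
    {ae @lebesgue3 R, forall p, box (@Rpos R) setT (Phi @` @Ical R) p ->
       offset_bragg beta Em EM Phi W f p = 0} ->
    {ae @lebesgue3 R, forall p, box (Efrak Em EM) setT (@Ical R) p ->
       f p = 0}.
Proof.
move=> f [fL2 [K [cK _ fK]]] Bf0.
pose Omega : set (R * R * R) := box (Efrak Em EM) setT (@Ical R).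
(* The zero extension that [offset_bragg] itself evaluates; its slices play the role of [h]. *)
pose g := f \_ Omega.
have [r Kr] := compact_sub_cube cK.
(* The same measure as [lebesgue3], written with the packed [lebesgue2] to exhibit its sigma-finite
   factors. *)
pose mu3 := (lebesgue2 R \x @lebesgue_measure R)%E.
have gr : {ae mu3, forall p,
    ~ cube r p -> g p = 0}.
  apply: (ae_mono _ fK) => p fp Bp; rewrite /g patchE.
  case: ifPn => //; rewrite inE => Op; apply: fp; split => // Kp.
  exact: Bp (Kr _ Kp).
have gi : mu3.-integrable setT (EFin \o g) by exact: square_integrable_integrable gr.
have mg := measurable_int _ gi.
(* [Phi x2 = 0] is excluded because [q1 0 x2] vanishes at [0]; being injective,
   [Phi] takes the value [0] at most once. *)
have aeB : {ae @lebesgue_measure R, forall x2, Ical x2 ->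
    Phi x2 != 0 /\ {ae lebesgue2 R, forall z, 0 < z.1 ->
      offset_bragg beta Em EM Phi W f (z, Phi x2) = 0}}.
  have /(diffeomorphism_negligible_preimage hPhi) N1 :
      (@lebesgue_measure R).-negligible [set 0].
    by exists [set 0]; split => //; rewrite lebesgue_measure_set1.
  have Bf0' : {ae mu3, forall p, box (@Rpos R) setT (Phi @` @Ical R) p ->
       offset_bragg beta Em EM Phi W f p = 0} by exact: Bf0.
  (* For almost every [eps] the equation holds at almost every [(E, s1)]; the bad [eps] are then
     pulled back to [x2]. *)
  have N2' := ae_ysection Bf0'.
  have N2 := diffeomorphism_negligible_preimage hPhi N2'.
  apply: negligibleS (negligibleU N1 N2) => x2 /= /not_implyP[Ix2 bad].
  have [P0|P0] := eqVneq (Phi x2) 0; [by left|right; split => // good].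
  apply: bad; split => //; apply: ae_mono good => z /[swap] z0; apply.
  by split => //; exists x2.
have slices0 : {ae @lebesgue_measure R, forall x2,
    {ae lebesgue2 R, forall z, g (z, x2) = 0}}.
  have h1 := ae_ysection gr.
  have h2 := ae_integrable2 gi.
  apply: (ae_mono2 _ aeB) (filterI h1 h2) => x2 Bx2 [gx2 ix2].
  have [Ix2|nIx2] := pselect (Ical x2); last first.
    by apply: aeW => z; rewrite /g patchE memNset// => -[].
  have [P0 {}Bx2] := Bx2 Ix2.
  have eps0 : 0 < Phi x2.
    by rewrite lt_neqAle eq_sym P0; have /andP[] := hPhiM _ Ix2.
  apply: (@bragg_slice_inj R Em (width beta x2) r (fun E u => W E u x2) W1
    (W2 ^~ x2) (q1 (Phi x2) x2) (fun z => g (z, x2))) => //.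
  - exact: width_gt0.
  - by move=> x; apply: differentiable_continuous; have [] := hW2C1 _ Ix2 x I.
  - by move=> u; exact: hW2nz.
  - exact: continuous_q1.
  - by move=> u; exact: q1_gt0.
  - by move=> E u E0; exact: hW.
  (* Points with [q < Em] lie outside [Efrak Em EM]. *)
  - move=> z zEm; rewrite /g patchE memNset// => -[[+ _] _].
    by rewrite /Efrak/= in_itv/= leNgt zEm.
  - apply: ae_mono gx2 => z zr [rz|rz]; apply: zr => /cubeP[/= z1 z2 _];
    by move: rz; rewrite ltNge ?z1 ?z2.
  (* At [eps = Phi x2] the transform recovers exactly [x2], hence integrates this slice. *)
  - have pinvPhi : pinv (@Ical R) Phi (Phi x2) = x2.
      by apply: pinvKV; [have [] := hPhi|rewrite inE].
    by apply: ae_mono Bx2 => z zB z0; rewrite -[RHS](zB z0) /offset_bragg/= pinvPhi.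
have g0 : {ae mu3, forall p, g p = 0}.
  apply: (ae_eq0_of_slices _ slices0).
  exact/measurable_EFinP.
apply: (ae_mono _ g0) => p gp Op; move: gp.
by rewrite /g patchE mem_set.
Qed.
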